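(* For all integers $m,n\ge 0$, $$\mathrm{LB}_{n+m}(x)=\sum_{j=0}^{m}\sum_{k=0}^{n}\binom{n}{k}L(m,j)\langle m+j\rangle_{n-k}\,x^{j}\,\mathrm{LB}_{k}(x).$$ In particular, letting $x=1$ gives $$\mathrm{LB}_{n+m}=\sum_{j=0}^{m}\sum_{k=0}^{n}\binom{n}{k}L(m,j)\langle m+j\rangle_{n-k}\,\mathrm{LB}_{k}.$$
   Context: Falling factorials: $(x)_0=1$, $(x)_n=x(x-1)\cdots(x-n+1)$ for $n\ge1$. Rising factorials: $\langle x\rangle_0=1$, $\langle x\rangle_n=x(x+1)\cdots(x+n-1)$ for $n\ge 1$. The Lah numbers $L(n,k)$ ($0\le k\le n$) are defined by the polynomial identity $\langle x\rangle_n=\sum_{k=0}^n L(n,k)(x)_k$ for $n\ge0$. The Lah-Bell polynomials are $\mathrm{LB}_n(x)=\sum_{k=0}^n L(n,k)x^k$ for $n\ge0$, and the Lah-Bell numbers are $\mathrm{LB}_n=\mathrm{LB}_n(1)=\sum_{k=0}^n L(n,k)$. *)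

(* Defs.v *)
From mathcomp Require Import all_boot all_order all_algebra.

Set Implicit Arguments.
Unset Strict Implicit.
Unset Printing Implicit Defensive.

Import GRing.Theory.
Local Open Scope ring_scope.

(* Taking [x := 'X] gives the polynomials (x)_n and <x>_n; taking [x] in the
   ring of coefficients gives their values. *)
Definition falling_fact (A : pzRingType) (x : A) (n : nat) : A :=
  \prod_(i < n) (x - i%:R).

Definition rising_fact (A : pzRingType) (x : A) (n : nat) : A :=
  \prod_(i < n) (x + i%:R).

Definition lah_row_spec (n : nat) (c : {ffun 'I_n.+1 -> int}) : bool :=
  rising_fact ('X : {poly int}) n
    == \sum_(k < n.+1) c k *: falling_fact ('X : {poly int}) k.

Lemma lah_row_exists (n : nat) : exists c, @lah_row_spec n c.
Proof.
suff [c Hc _] : exists2 c : nat -> int,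
    rising_fact ('X : {poly int}) n
      = \sum_(k < n.+1) c k *: falling_fact ('X : {poly int}) k
    & forall k, (n < k)%N -> c k = 0.
  exists [ffun k : 'I_n.+1 => c k]; apply/eqP; rewrite Hc.
  by apply: eq_bigr => k _; rewrite ffunE.
elim: n => [|n [c IHc c0]].
  exists (fun k => (k == 0)%N%:R) => [|[]//].
  by rewrite big_ord1 scale1r /rising_fact /falling_fact !big_ord0.
exists (fun k => (if k is k'.+1 then c k' else 0) + (n + k)%:R * c k); last first.
  by case=> // k ltnk; rewrite !c0 ?mulr0 ?addr0 // ltnW.
under eq_bigr do rewrite scalerDl.
rewrite big_split /= big_ord_recl /= scale0r add0r.
rewrite [X in _ = _ + X]big_ord_recr /= (c0 n.+1) // mulr0 scale0r addr0 -big_split.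
rewrite /rising_fact big_ord_recr /= -/(rising_fact 'X n) IHc mulr_suml.
apply: eq_bigr => k _ /=.
rewrite [in RHS]mulrC -(scalerA (c k)) -scalerDr -scalerAl; congr (_ *: _).
rewrite /falling_fact big_ord_recr /= -/(falling_fact 'X k).
rewrite scaler_nat -[X in _ = _ + X]mulr_natr -mulrDr; congr (_ * _).
by rewrite natrD [n%:R + _]addrC addrA addrNK.
Qed.

(* L(n, k), extended by 0 for k > n. *)
Definition lah (n k : nat) : int :=
  oapp (xchoose (lah_row_exists n)) 0 (insub k : option 'I_n.+1).

Lemma lahE (n : nat) :
  rising_fact ('X : {poly int}) n
    = \sum_(k < n.+1) lah n k *: falling_fact ('X : {poly int}) k.
Proof.
rewrite {1}(eqP (xchooseP (lah_row_exists n))).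
by apply: eq_bigr => k _; rewrite /lah valK.
Qed.

Lemma falling_fact_free (R : nzRingType) (n : nat) (c : nat -> R) :
  \sum_(k < n) c k *: falling_fact ('X : {poly R}) k = 0 ->
  forall k, (k < n)%N -> c k = 0.
Proof.
have ffE k : falling_fact ('X : {poly R}) k = \prod_(i < k) ('X - (i%:R)%:P).
  by apply: eq_bigr => i _; rewrite polyC_natr.
have sz k : size (falling_fact ('X : {poly R}) k) = k.+1.
  by rewrite ffE size_prod_XsubC /index_enum -enumT size_enum_ord.
have lc k : (falling_fact ('X : {poly R}) k)`_k = 1.
  have /monicP : falling_fact ('X : {poly R}) k \is monic.
    by rewrite ffE monic_prod_XsubC.
  by rewrite lead_coefE sz.
elim: n => [//|n IHn]; rewrite big_ord_recr /= => H0.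
have cn0 : c n = 0.
  move/(congr1 (fun p : {poly R} => p`_n)): H0.
  rewrite coefD coefZ lc mulr1 coef0 coef_sum big1 ?add0r // => i _.
  by rewrite coefZ nth_default ?mulr0 // sz.
move: H0; rewrite cn0 scale0r addr0 => /IHn H k.
by rewrite ltnS leq_eqVlt => /predU1P[->|/H].
Qed.

Lemma lah_unique (n : nat) (c : nat -> int) :
  rising_fact ('X : {poly int}) n
    = \sum_(k < n.+1) c k *: falling_fact ('X : {poly int}) k ->
  forall k, (k <= n)%N -> c k = lah n k.
Proof.
move=> Hc k lekn; apply/eqP; rewrite -subr_eq0; apply/eqP.
apply: (@falling_fact_free _ n.+1 (fun k => c k - lah n k)) => //.
under eq_bigr do rewrite scalerBl.
by rewrite sumrB -Hc -lahE subrr.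
Qed.

Definition lah_bell_poly (n : nat) : {poly int} :=
  \sum_(k < n.+1) lah n k *: 'X^k.

Definition lah_bell (n : nat) : int := (lah_bell_poly n).[1].

Lemma lah_bellE (n : nat) : lah_bell n = \sum_(k < n.+1) lah n k.
Proof.
rewrite /lah_bell /lah_bell_poly horner_sum.
by apply: eq_bigr => k _; rewrite hornerZ hornerXn expr1n mulr1.
Qed.

(* Main.v *)
From HB Require Import structures.
Require Import Defs.
From mathcomp Require Import all_boot all_order all_algebra.

Set Implicit Arguments.
Unset Strict Implicit.
Unset Printing Implicit Defensive.

Import GRing.Theory.
Local Open Scope ring_scope.

(** Let [umbral] be the linear map sending [x^k] to [(x)_k]. It is injective,
    maps [LB_n] to [<x>_n], and sends [x^j p(x)] to [(x)_j (umbral p)(x - j)].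
    It therefore suffices to compare the images of both sides, where the claim
    follows from [<x>_{n+m} = <x>_m <x+m>_n], the expansion of [<x>_m] in falling
    factorials, and Vandermonde's identity for [<(x - j) + (m + j)>_n]. *)

Lemma rmorph_rising_fact (A B : pzRingType) (f : {rmorphism A -> B}) (x : A) n :
  f (rising_fact x n) = rising_fact (f x) n.
Proof.
by rewrite rmorph_prod; apply: eq_bigr => i _; rewrite rmorphD rmorph_nat.
Qed.

Lemma rmorph_falling_fact (A B : pzRingType) (f : {rmorphism A -> B}) (x : A) n :
  f (falling_fact x n) = falling_fact (f x) n.
Proof.
by rewrite rmorph_prod; apply: eq_bigr => i _; rewrite rmorphB rmorph_nat.
Qed.

Lemma rising_factS (A : pzRingType) (x : A) n :
  rising_fact x n.+1 = rising_fact x n * (x + n%:R).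
Proof. exact: big_ord_recr. Qed.

Lemma rising_factD (A : pzRingType) (x : A) m n :
  rising_fact x (m + n) = rising_fact x m * rising_fact (x + m%:R) n.
Proof.
rewrite /rising_fact big_split_ord; congr (_ * _).
by apply: eq_bigr => i _; rewrite -addrA -natrD.
Qed.

Lemma falling_factD (A : pzRingType) (x : A) m n :
  falling_fact x (m + n) = falling_fact x m * falling_fact (x - m%:R) n.
Proof.
rewrite /falling_fact big_split_ord; congr (_ * _).
by apply: eq_bigr => i _; rewrite /= natrD opprD addrA.
Qed.

(** Induction on [n]: the new factor [x + y + n] splits as [(x + k) + (y + (n - k))], and each half
    lengthens one of the two rising factorials in the [k]-th term. *)
Lemma rising_fact_Vandermonde (A : comPzRingType) (x y : A) n :
  rising_fact (x + y) n =
    \sum_(k < n.+1) 'C(n, k)%:R * (rising_fact x k * rising_fact y (n - k)).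
Proof.
elim: n => [|n IHn].
  by rewrite big_ord1 /rising_fact !big_ord0 !mulr1.
have splitE (k : 'I_n.+1) :
    'C(n, k)%:R * (rising_fact x k * rising_fact y (n - k)) * (x + y + n%:R)
    = 'C(n, k)%:R * (rising_fact x k.+1 * rising_fact y (n - k))
    + 'C(n, k)%:R * (rising_fact x k * rising_fact y (n.+1 - k)).
  have lekn : (k <= n)%N by rewrite -ltnS.
  rewrite subSn // !rising_factS.
  have -> : x + y + n%:R = (x + k%:R) + (y + (n - k)%:R).
    by rewrite addrACA -natrD subnKC.
  rewrite mulrDr -!mulrA; congr (_ * _ + _).
  by congr (_ * _); exact: mulrC.
rewrite rising_factS IHn mulr_suml (eq_bigr _ (fun k _ => splitE k)) big_split.
rewrite [RHS]big_ord_recl.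
(* Pascal's rule splits each term with positive index in two, to be matched with the two halves from
   [splitE]. The second sum is shifted by one; its extra top term vanishes because
   ['C(n, n.+1) = 0]. *)
under [in RHS]eq_bigr => k _.
  rewrite lift0 binS natrD mulrDl subSS addrC.
  over.
rewrite big_split /= addrCA; congr (_ + _).
by rewrite big_ord_recl [in RHS]big_ord_recr /= (bin_small (ltnSn n)) mul0r addr0 !bin0.
Qed.

Section Umbral.

Variable R : comNzRingType.
Implicit Types p q : {poly R}.

Definition umbral p : {poly R} :=
  \sum_(k < size p) p`_k *: falling_fact 'X k.

(** Coefficients past the size are zero. A bound independent of [p] lets sums for different
    polynomials be added termwise. *)
Lemma umbral_widen p n : (size p <= n)%N ->
  umbral p = \sum_(k < n) p`_k *: falling_fact 'X k.
Proof.
move=> lepn; rewrite /umbral (big_ord_widen n (fun k => p`_k *: falling_fact 'X k)) //.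
rewrite [RHS](bigID (fun k : 'I_n => k < size p)%N) /= [X in _ + X]big1 ?addr0 // => k.
by rewrite -leqNgt => /(nth_default 0) ->; rewrite scale0r.
Qed.

Lemma umbral_is_linear : linear umbral.
Proof.
move=> a p q; set n := maxn (size p) (size q).
rewrite (@umbral_widen p n) ?leq_maxl // (@umbral_widen q n) ?leq_maxr //.
rewrite (@umbral_widen _ n); last first.
  rewrite (leq_trans (size_polyD _ _)) // geq_max leq_maxr andbT.
  by rewrite (leq_trans (size_scale_leq _ _)) ?leq_maxl.
rewrite scaler_sumr -big_split; apply: eq_bigr => k _.
by rewrite coefD coefZ scalerDl scalerA.
Qed.

HB.instance Definition _ :=
  GRing.isLinear.Build R {poly R} {poly R} _ umbral umbral_is_linear.

Lemma umbralXn k : umbral 'X^k = falling_fact 'X k.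
Proof.
rewrite /umbral size_polyXn big_ord_recr /= coefXn eqxx scale1r big1 ?add0r //.
by move=> i _; rewrite coefXn ltn_eqF // scale0r.
Qed.

(** Falling factorials are linearly independent, so a zero image of [p - q] forces all its
    coefficients to vanish. *)
Lemma umbral_inj : injective umbral.
Proof.
move=> p q /eqP; rewrite -subr_eq0 -linearB => /eqP upq0.
apply/eqP; rewrite -subr_eq0; apply/eqP/polyP => k; rewrite coef0.
have [lek|] := ltnP k (size (p - q)); last exact: nth_default.
exact: (@falling_fact_free _ _ (fun i => (p - q)`_i) upq0).
Qed.

(** By linearity [p] may be taken to be a monomial ['X^k], where this is
    [(x)_{j+k} = (x)_j (x-j)_k]. *)
Lemma umbral_mulXn j p :
  umbral ('X^j * p) = falling_fact 'X j * (umbral p \Po ('X - j%:R)).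
Proof.
rewrite -[p]coefK poly_def mulr_sumr !(linear_sum umbral) linear_sum mulr_sumr.
apply: eq_bigr => k _; rewrite -scalerAr -exprD !linearZ /= !umbralXn.
by rewrite falling_factD rmorph_falling_fact /= comp_polyX -scalerAr.
Qed.

End Umbral.

(** Replacing each [x^k] by [(x)_k] turns [LB_n] into the expansion that defines the Lah numbers. *)
Lemma umbral_lah_bell_poly n : umbral (lah_bell_poly n) = rising_fact 'X n.
Proof.
by rewrite lahE linear_sum; apply: eq_bigr => k _; rewrite linearZ /= umbralXn.
Qed.

Lemma lah_bell_polyD (m n : nat) :
  lah_bell_poly (n + m) =
    \sum_(j < m.+1) \sum_(k < n.+1)
      ('C(n, k)%:R * lah m j * rising_fact (m + j)%:R (n - k)) *:
        ('X^j * lah_bell_poly k).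
Proof.
(* Putting the [m] factors first makes row [m] of the Lah numbers appear, with cofactor
   [<x+m>_n]. *)
apply: umbral_inj; rewrite umbral_lah_bell_poly addnC rising_factD lahE.
rewrite mulr_suml linear_sum; apply: eq_bigr => j _.
have -> : 'X + m%:R = ('X - j%:R) + (m + j)%:R :> {poly int}.
  by rewrite natrD [m%:R + _]addrC addrA subrK.
rewrite rising_fact_Vandermonde mulr_sumr linear_sum; apply: eq_bigr => k _.
rewrite linearZ /= umbral_mulXn umbral_lah_bell_poly rmorph_rising_fact /=.
(* The rising factorial of the constant polynomial [m + j] is the constant given by its integer
   value, so it can match the scalar on the right. *)
rewrite comp_polyX -polyC_natr -rmorph_rising_fact -!mul_polyC !rmorphM /=.
rewrite polyC_natr -!mulrA [RHS]mulrCA; congr (_ * _).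
by rewrite mulrCA; congr (_ * _); rewrite mulrA mulrC.
Qed.

Theorem theorem2p2 (m n : nat) :
  lah_bell_poly (n + m) =
    \sum_(j < m.+1) \sum_(k < n.+1)
      ('C(n, k)%:R * lah m j * rising_fact (m + j)%:R (n - k)) *:
        ('X^j * lah_bell_poly k)
  /\
  lah_bell (n + m) =
    \sum_(j < m.+1) \sum_(k < n.+1)
      'C(n, k)%:R * lah m j * rising_fact (m + j)%:R (n - k) * lah_bell k.
Proof.
split; first exact: lah_bell_polyD.
rewrite /lah_bell lah_bell_polyD horner_sum; apply: eq_bigr => j _.
rewrite horner_sum; apply: eq_bigr => k _.
by rewrite hornerZ hornerM hornerXn expr1n mul1r.
Qed.
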